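(* Let $e$ be the number of edges of a compact automaton $\mathcal A$ recognizing all (and only the) suffixes of a string $T$. Then $T$ has a string attractor of size $e$.
   Context: A string attractor of a string $T$ of length $n$ is a set $\Gamma\subseteq\{1,\dots,n\}$ such that every substring $T[i..j]$ has an occurrence $T[i'..j']=T[i..j]$ with $p\in[i',j']$ for some $p\in\Gamma$. A compact automaton here is a path-compressed deterministic directed acyclic graph with a source node (the initial state), whose edges are labeled by non-empty strings (edges leaving the same node start with distinct characters), such that the strings spelled by paths from the source to the sink (final) node are exactly the suffixes of $T$; in particular every substring of $T$ is spelled by a path from the source, possibly ending inside an edge label (e.g., the CDAWG of $T$).
   Formalization: A set of exactly e positions cannot exist when e exceeds the length n of T (e.g. abab$ with its leaf-merged suffix tree: e = 7, n = 5), so the attractor is shown to have size at most e, and exactly e whenever e ≤ n. *)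

(* Defs.v *)
From HB Require Import structures.
From mathcomp Require Import all_boot.

Set Implicit Arguments.
Unset Strict Implicit.
Unset Printing Implicit Defensive.

(* T[i..j], both ends included, positions counted from 0. *)
Definition substring (A : Type) (T : seq A) (i j : nat) : seq A :=
  take (j - i).+1 (drop i T).

(* The positions 1..n of the text are represented by 0..n-1 = 'I_n. *)
Definition string_attractor (A : eqType) (T : seq A)
    (G : {set 'I_(size T)}) : Prop :=
  forall i j : 'I_(size T), i <= j ->
  exists i' j' : 'I_(size T),
    [/\ i' <= j', substring T i' j' = substring T i j
      & exists2 p : 'I_(size T), p \in G & i' <= p <= j'].

(* Edges form a type of their own because parallel edges (with different
   labels) between the same two nodes occur, e.g. in CDAWGs. *)
Record labeled_graph (A : eqType) := LabeledGraph {
  node : finType;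
  edge : finType;
  esrc : edge -> node;
  etgt : edge -> node;
  label : edge -> seq A;
  source : node;
  sink : node
}.

Section Paths.
Variables (A : eqType) (M : labeled_graph A).

Fixpoint walk (u : node M) (p : seq (edge M)) (v : node M) : bool :=
  if p is e :: p' then (esrc e == u) && walk (etgt e) p' v else u == v.

Definition spelling (p : seq (edge M)) : seq A := flatten (map (@label A M) p).

Definition accepts (w : seq A) : Prop :=
  exists2 p : seq (edge M), walk (source M) p (sink M) & spelling p = w.

Definition indegree (v : node M) : nat := #|[set e : edge M | etgt e == v]|.

Definition outdegree (v : node M) : nat := #|[set e : edge M | esrc e == v]|.

Definition acyclic_graph : Prop :=
  forall (u : node M) (p : seq (edge M)), walk u p u -> p = [::].

Definition deterministic_graph : Prop :=
  forall e1 e2 : edge M,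
    esrc e1 = esrc e2 -> ohead (label e1) = ohead (label e2) -> e1 = e2.

(* No inner node can be suppressed by concatenating the labels of its only
   incoming and its only outgoing edge. This is implied by the stronger
   requirement that inner nodes have out-degree at least 2. *)
Definition path_compressed : Prop :=
  forall v : node M, v != source M -> v != sink M ->
    ~ (indegree v = 1 /\ outdegree v = 1).

End Paths.

Record compact_automaton (A : eqType) := CompactAutomaton {
  graph_of :> labeled_graph A;
  label_nonempty : forall e : edge graph_of, label e <> [::];
  source_indegree : indegree (source graph_of) = 0;
  sink_outdegree : outdegree (sink graph_of) = 0;
  is_acyclic : acyclic_graph graph_of;
  is_deterministic : deterministic_graph graph_of;
  is_path_compressed : path_compressed graph_of
}.

(* Suffixes are non-empty here: for T non-empty, the empty word is accepted
   only if source = sink, and then acyclicity excludes any other word. *)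
Definition recognizes_suffixes (A : eqType) (M : labeled_graph A)
    (T : seq A) : Prop :=
  forall w : seq A, w <> [::] -> (accepts M w <-> suffix w T).

(* Main.v *)
Require Import Defs.
From HB Require Import structures.
From mathcomp Require Import all_boot.
From mathcomp Require Import zify.

Set Implicit Arguments.
Unset Strict Implicit.
Unset Printing Implicit Defensive.

(** For every edge [e] from which the sink can be reached, fix a word [s_e]
    spelled by a path that starts with [e] and ends in the sink; the attractor
    consists of the starting positions of the suffixes [s_e]. If the path
    spelling a substring [w] ends inside [e], then [w] is a prefix of [x ++ s_e]
    with [x] spelled from the source to the origin of [e]. The automaton accepts
    [x ++ s_e], so this word is a suffix of [T], and the occurrence of [w] at its
    beginning contains the first position of [s_e]. *)

(** Serves to pad an attractor to an exact size; elements of the complement are added one by one. *)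
Lemma superset_of_card (I : finType) (G : {set I}) (m : nat) :
  #|G| <= m -> m <= #|I| -> exists2 G' : {set I}, G \subset G' & #|G'| = m.
Proof.
move=> /subnKC <-; elim: (m - _) => [_ | d IHd ltI].
  by exists G => //; rewrite addn0.
have [|G' sGG' cardG'] := IHd; first by lia.
have /card_gt0P[x] : 0 < #|~: G'| by have := cardsC G'; lia.
rewrite inE => xG'; exists (x |: G'); first exact: subset_trans sGG' (subsetUr _ _).
by rewrite cardsU1 xG' cardG'; lia.
Qed.

Lemma string_attractorS (A : eqType) (T : seq A) (G G' : {set 'I_(size T)}) :
  G \subset G' -> string_attractor G -> string_attractor G'.
Proof.
move=> /subsetP sGG' attrG i j /attrG[i' [j' [leij eqT [p pG lep]]]].
by exists i', j'; split=> //; exists p => //; apply: sGG'.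
Qed.

Section Spelling.
Variables (A : eqType) (M : labeled_graph A).
Implicit Types (u v w : node M) (e : edge M) (p q : seq (edge M)).

Lemma walk_cat u p q w :
  walk u (p ++ q) w <-> exists2 v, walk u p v & walk v q w.
Proof.
elim: p u => [|e p IHp] u /=.
  by split=> [uw | [v /eqP->]] //; exists u.
split=> [/andP[-> /IHp[v pv vq]] | [v /andP[-> pv] vq]]; first by exists v.
by apply/IHp; exists v.
Qed.

Lemma spelling_cat p q : spelling (p ++ q) = spelling p ++ spelling q.
Proof. by rewrite /spelling map_cat flatten_cat. Qed.

Lemma spelling_cons e p : spelling (e :: p) = label e ++ spelling p.
Proof. by []. Qed.

(** Locates the edge [e] of the path whose label carries the character at offset [k]. *)
Lemma split_spelling p k : k < size (spelling p) ->
  exists p1 e p2,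
    [/\ p = p1 ++ e :: p2, size (spelling p1) <= k
      & k < size (spelling p1 ++ label e)].
Proof.
elim: p k => [|e p IHp] k //; rewrite spelling_cons size_cat => ltk.
have [ltke | leek] := ltnP k (size (label e)); first by exists [::], e, p.
have [|p1 [e' [p2 [-> le1 lt1]]]] := IHp (k - size (label e)); first by lia.
exists (e :: p1), e', p2; split=> //; move: le1 lt1; rewrite spelling_cons !size_cat; lia.
Qed.

Lemma leq_size_spelling p :
  (forall e, label e <> [::]) -> size p <= size (spelling p).
Proof.
move=> lab0; elim: p => //= e p IHp; rewrite spelling_cons size_cat.
by case: (label e) (lab0 e) => //= a s _; lia.
Qed.

End Spelling.

Section Attractor.
Variables (A : eqType) (T : seq A) (M : compact_automaton A).
Hypothesis recT : recognizes_suffixes M T.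

(* Labels are non-empty, so completions of length at most [size T] suffice and
   the search ranges over a finite type. *)
Definition edge_position (e : edge M) : option 'I_(size T) :=
  if [pick q : {bseq (size T) of edge M} | walk (etgt e) q (sink M)] is Some q
  then insub (size T - size (spelling (e :: q))) else None.

Definition edge_positions : {set 'I_(size T)} :=
  [set p | Some p \in edge_position @: setT].

Lemma card_edge_positions : #|edge_positions| <= #|edge M|.
Proof.
rewrite -(card_imset _ (@Some_inj _)) -cardsT.
apply: leq_trans (leq_imset_card edge_position _).
by apply/subset_leq_card/subsetP => _ /imsetP[p + ->]; rewrite inE.
Qed.

Lemma label_gt0 (e : edge M) : 0 < size (label e).
Proof. by case: (label e) (@label_nonempty _ _ e). Qed.

(** The path [p] only witnesses that the search succeeds; the completion [q] found may differ from
    it. *)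
Lemma edge_positionP (e : edge M) (p : seq (edge M)) :
  size p <= size T -> walk (etgt e) p (sink M) ->
  exists2 q, walk (etgt e) q (sink M) &
    forall h : size T - size (spelling (e :: q)) < size T,
      Ordinal h \in edge_positions.
Proof.
move=> lepT pe; case E: [pick q : {bseq (size T) of edge M} | walk (etgt e) q (sink M)] => [q|].
  have qe : walk (etgt e) q (sink M) by case: pickP E => // q' q'e [<-].
  exists q => // h; rewrite inE; apply/imsetP; exists e => //.
  by rewrite /edge_position E insubT.
by case: pickP E => // /(_ (Bseq lepT)); rewrite /= pe.
Qed.

Lemma edge_positions_attractor : string_attractor edge_positions.
Proof.
move=> i j leij; set k := j - i.
have ltj := ltn_ord j; have szi := size_drop i T.
(* Follow the whole suffix starting at [i], not just the substring: its path reaches the sink, so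
   the edge met at offset [k], the last character of the substring, has a completion. *)
have [p walkp spellp] : accepts M (drop i T).
  apply/recT; last exact: suffix_drop.
  by move=> Ti; move: szi; rewrite Ti /=; lia.
have [|p1 [e [p2 [defp le1 lt1]]]] := @split_spelling _ _ p k; first by rewrite spellp; lia.
move: walkp; rewrite defp => /walk_cat[u walk1 /andP[/eqP eu walk2]].
have le2 : size p2 <= size T.
  apply: leq_trans (leq_size_spelling _ (@label_nonempty _ M)) _.
  move: szi; rewrite -spellp defp spelling_cat spelling_cons !size_cat; lia.
have [q walkq posq] := edge_positionP le2 walk2.
set x := spelling p1 in le1 lt1; set s := spelling (e :: q) in posq.
have s_gt0 : 0 < size s by rewrite size_cat; have := label_gt0 e; lia.
have /suffixP[y defT] : suffix (x ++ s) T.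
  apply/recT; first by move/(congr1 size); rewrite size_cat /=; lia.
  exists (p1 ++ e :: q); last by rewrite spelling_cat.
  by apply/walk_cat; exists u => //=; rewrite eu eqxx.
have szT : size T = size y + (size x + size s) by rewrite {1}defT !size_cat.
have ks : k < size x + size s by move: lt1; rewrite /s spelling_cons !size_cat; lia.
have hi : size y < size T by lia.
have hj : size y + k < size T by lia.
have hp : size T - size s < size T by lia.
(* With [T = y ++ x ++ s], the new occurrence starts right after [y]. *)
exists (Ordinal hi), (Ordinal hj); split=> /=; first by lia.
  (* Both suffixes start with [x ++ label e], which has more than [k] characters. *)
  rewrite /substring addKn -/k {1}defT drop_size_cat // -spellp defp.
  rewrite spelling_cat /s !spelling_cons -/x !catA.
  by rewrite !(takel_cat _ lt1).
(* The word [s] starts at [size y + size x], and [size x <= k]. *)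
by exists (Ordinal hp) => //=; lia.
Qed.

End Attractor.

Theorem theorem3p10 (A : eqType) (T : seq A) (M : compact_automaton A) :
  recognizes_suffixes M T ->
  exists G : {set 'I_(size T)},
    [/\ string_attractor G,
        #|G| <= #|edge M|
      & #|edge M| <= size T -> #|G| = #|edge M|].
Proof.
move=> recT; have attrG := edge_positions_attractor recT.
have leG := card_edge_positions T M.
(* With more edges than positions no set of positions has exactly that size, so the unpadded set is
   taken. *)
have [leMT | ltTM] := leqP #|edge M| (size T); last first.
  by exists (edge_positions T M); split=> // ?; lia.
have [|G sG cardG] := superset_of_card leG; first by rewrite card_ord.
by exists G; split; [apply: string_attractorS sG attrG | rewrite cardG |].
Qed.
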